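(* Let $G$ be a connected graph on $n\ge2$ vertices, with Laplacian eigenvalues $0=\lambda_1<\lambda_2\le\cdots\le\lambda_n$ and corresponding orthonormal eigenvectors $u_1=\frac1{\sqrt n}\mathbf 1,u_2,\dots,u_n$. Let $U=[u_2\ u_3\ \cdots\ u_n]$, $D_L=\operatorname{diag}(1/\lambda_2,\dots,1/\lambda_n)$ and $M_L=U^\top\Delta U$. With respect to the Laplacian eigenbasis $\{u_2,\dots,u_n\}$ of $\mathbf 1^\perp$, the restriction of the resistance Laplacian $\mathcal R$ to $\mathbf 1^\perp$ is represented by \[ U^\top\mathcal R\,U=2n\bar d\,I_{n-1}+2D_L+nM_L . \]
   Context: $G=(V,E)$ is a finite, simple, connected, undirected, unweighted graph with vertex set $V=\{1,\dots,n\}$. $L=D_G-A$ is its combinatorial Laplacian (degree matrix minus adjacency matrix). $\mathbf 1\in\mathbb R^n$ is the all-ones vector, $I$ (or $I_{n-1}$) an identity matrix. $L^\dagger$ is the Moore--Penrose inverse of $L$, i.e. the unique symmetric matrix with $LL^\dagger=L^\dagger L=I-\frac1n\mathbf 1\mathbf 1^\top$ and $L^\dagger\mathbf 1=\mathbf 0$. The effective resistance is $r_{ij}=(L^\dagger)_{ii}+(L^\dagger)_{jj}-2(L^\dagger)_{ij}$, the resistance matrix is $R=(r_{ij})$, and the resistance Laplacian is $\mathcal R=\operatorname{diag}(R\mathbf 1)-R$ (which satisfies $\mathcal R\mathbf 1=\mathbf 0$, so $\mathbf 1^\perp$ is invariant). Put $d_i=(L^\dagger)_{ii}$, $D=\operatorname{diag}(d_1,\dots,d_n)$,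 $\bar d=\frac1n\operatorname{tr}(L^\dagger)$, $\Delta=D-\bar d I$ (resistance deviation matrix). *)

(* Defs.v *)
From mathcomp Require Import all_boot all_order all_algebra.
From mathcomp Require Import classical_sets reals.
Set Implicit Arguments.
Unset Strict Implicit.
Unset Printing Implicit Defensive.
Import Order.TTheory GRing.Theory Num.Theory.
Local Open Scope ring_scope.

Section Definitions.
Variables (R : realType) (n : nat).
Implicit Types (e : rel 'I_n) (A L P T W : 'M[R]_n).

Definition simple_graph e := symmetric e /\ irreflexive e.

Definition connected_graph e := forall i j : 'I_n, connect e i j.

Definition ones : 'cV[R]_n := const_mx 1.

Definition adjacency e : 'M[R]_n := \matrix_(i, j) (e i j)%:R.

Definition degree_mx e : 'M[R]_n := diag_mx (\row_i #|[set j | e i j]|%:R).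

Definition laplacian e : 'M[R]_n := degree_mx e - adjacency e.

Definition centering : 'M[R]_n := 1%:M - n%:R^-1 *: (ones *m ones^T).

Definition is_laplacian_pinv L P : Prop :=
  [/\ P^T = P, L *m P = centering, P *m L = centering & P *m ones = 0].

(* A definite description: for a connected simple graph, [laplacian_pinvP] and
   [is_laplacian_pinv_uniq] below give existence and uniqueness. The default
   value 0 is only taken when there is no such matrix. *)
Definition laplacian_pinv e : 'M[R]_n :=
  xget 0 [set P | is_laplacian_pinv (laplacian e) P]%classic.

Definition effective_resistance e (i j : 'I_n) : R :=
  let P := laplacian_pinv e in P i i + P j j - 2 * P i j.

Definition resistance_mx e : 'M[R]_n :=
  \matrix_(i, j) effective_resistance e i j.

Definition resistance_laplacian e : 'M[R]_n :=
  diag_mx (resistance_mx e *m ones)^T - resistance_mx e.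

Definition mean_pinv_diag e : R := n%:R^-1 * \tr (laplacian_pinv e).

Definition resistance_deviation e : 'M[R]_n :=
  diag_mx (\row_i laplacian_pinv e i i) - (mean_pinv_diag e)%:M.

(* Square matrix whose row space consists of the transposes of the vectors x
   with x^T *m ones = 0. *)
Definition ones_orth : 'M[R]_n := kermx ones.

(* The subspace is given by the row space of W, whereas T acts on column vectors
   and the basis vectors are the columns of B; hence the transpositions. The last
   clause says that column k of M holds the coordinates of T *m col k B in B. *)
Definition represents_restriction m W T (B : 'M[R]_(n, m)) (M : 'M[R]_m) :=
  [/\ stablemx W T^T, (B^T == W)%MS, row_free B^T & T *m B = B *m M].

(* The index i of lam and u corresponds to i + 1 in 1-based numbering. *)
Definition laplacian_eigenbasis e (n_gt1 : (1 < n)%N)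
    (lam : 'I_n -> R) (u : 'I_n -> 'cV[R]_n) : Prop :=
  let i1 := Ordinal (ltnW n_gt1) in
  let i2 := Ordinal n_gt1 in
  [/\ lam i1 = 0 /\ 0 < lam i2,
      forall i j : 'I_n, (i <= j)%N -> lam i <= lam j,
      forall i, laplacian e *m u i = lam i *: u i,
      forall i j, (u i)^T *m u j = (i == j)%:R%:M
    & u i1 = (Num.sqrt n%:R)^-1 *: ones].

End Definitions.

Arguments ones R n : clear implicits.
Arguments centering R n : clear implicits.
Arguments ones_orth R n : clear implicits.
Arguments laplacian R {n} e.
Arguments laplacian_pinv R {n} e.
Arguments resistance_mx R {n} e.
Arguments resistance_laplacian R {n} e.
Arguments mean_pinv_diag R {n} e.
Arguments resistance_deviation R {n} e.

Section Pseudoinverse.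
Variables (R : realType) (n : nat).
Implicit Types (L P : 'M[R]_n) (e : rel 'I_n).

Lemma is_laplacian_pinv_uniq L P P' :
  is_laplacian_pinv L P -> is_laplacian_pinv L P' -> P = P'.
Proof.
move=> [_ _ PL P1] [P'T LP' _ P'1].
have : P *m (L *m P') = P *m L *m P' by rewrite mulmxA.
rewrite LP' PL /centering mulmxBr mulmxBl mulmx1 mul1mx.
rewrite -scalemxAr -scalemxAl mulmxA P1 mul0mx scaler0 subr0.
have -> : ones R n *m (ones R n)^T *m P' = 0.
  by rewrite -mulmxA -{1}P'T -trmx_mul P'1 trmx0 mulmx0.
by rewrite scaler0 subr0.
Qed.

Lemma laplacianE e (x : 'cV[R]_n) i :
  (laplacian R e *m x) i 0 = \sum_j (e i j)%:R * (x i 0 - x j 0).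
Proof.
rewrite mulmxBl mxE mul_diag_mx !mxE -sum1_card natr_sum mulr_suml.
rewrite (eq_bigl (fun j => e i j)); last by move=> j; rewrite inE.
rewrite big_mkcond -sumrB; apply: eq_bigr => j _; rewrite !mxE.
by case: (e i j); rewrite ?mul1r ?mul0r ?subrr.
Qed.

Lemma laplacian_sym e : symmetric e -> (laplacian R e)^T = laplacian R e.
Proof.
move=> es; rewrite linearB /= tr_diag_mx; congr (_ - _).
by apply/matrixP => i j; rewrite !mxE es.
Qed.

Lemma laplacian_ones e : laplacian R e *m ones R n = 0.
Proof.
apply/matrixP => i j; rewrite ord1 laplacianE [RHS]mxE big1 // => k _.
by rewrite !mxE subrr mulr0.
Qed.

Lemma laplacian_ker e (x : 'cV[R]_n) : symmetric e -> connected_graph e ->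
  laplacian R e *m x = 0 -> forall i j, x i 0 = x j 0.
Proof.
move=> es ec Lx0.
pose E := \sum_i \sum_j (e i j)%:R * (x i 0 - x j 0) ^+ 2.
have E0 : E = 0.
  have S0 : \sum_i \sum_j (e i j)%:R * (x i 0 - x j 0) * x i 0 = 0.
    rewrite big1 // => i _; rewrite -mulr_suml -laplacianE Lx0 mxE mul0r //.
  have S1 : \sum_i \sum_j (e i j)%:R * (x i 0 - x j 0) * x j 0 = 0.
    rewrite exchange_big /= -[RHS]oppr0 -[in RHS]S0 -sumrN.
    apply: eq_bigr => i _; rewrite -sumrN; apply: eq_bigr => j _.
    by rewrite es -mulNr -mulrN opprB.
  rewrite -[RHS]subr0 -[in X in X - _]S0 -[in X in _ - X]S1 -sumrB.
  apply: eq_bigr => i _; rewrite -sumrB; apply: eq_bigr => j _.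
  by rewrite -mulrBr expr2 mulrA.
have ge0 i j : 0 <= (e i j)%:R * (x i 0 - x j 0) ^+ 2.
  by rewrite mulr_ge0 ?sqr_ge0 ?ler0n.
have edge i j : e i j -> x i 0 = x j 0.
  move=> eij.
  have ge0s k : true -> 0 <= \sum_j (e k j)%:R * (x k 0 - x j 0) ^+ 2.
    by move=> _; apply: sumr_ge0.
  have Ei := psumr_eq0P ge0s E0 (i := i) isT.
  have /eqP := psumr_eq0P (fun j _ => ge0 i j) Ei (i := j) isT.
  by rewrite eij mul1r sqrf_eq0 subr_eq0 => /eqP.
move=> i j; have /connectP[p + ->] := ec i j.
by elim: p i => //= k p IH i /andP[/edge -> /IH].
Qed.

Lemma laplacian_pinvP e : symmetric e -> connected_graph e ->
  is_laplacian_pinv (laplacian R e) (laplacian_pinv R e).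
Proof.
move=> es ec; apply: (xgetPex 0 (P := is_laplacian_pinv _)).
have [n0|n_gt0] := posnP n.
  by exists 0; split; apply/matrixP => -[k lt_kn]; exfalso; rewrite n0 in lt_kn.
pose i0 := Ordinal n_gt0.
set L := laplacian R e; set o := ones R n; set c : R := n%:R^-1.
pose J := c *: (o *m o^T); pose K := L + J.
have oo : o^T *m o = n%:R%:M.
  apply/matrixP => i j; rewrite !ord1 !mxE.
  rewrite (eq_bigr (fun=> 1)); last by move=> k _; rewrite !mxE mulr1.
  by rewrite sumr_const card_ord.
have cn : c * n%:R = 1 by rewrite mulVf // pnatr_eq0 -?lt0n.
have Jo : J *m o = o.
  by rewrite -scalemxAl -mulmxA oo mul_mx_scalar scalerA cn scale1r.
have LT : L^T = L by apply: laplacian_sym.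
have JT : J^T = J by rewrite linearZ /= trmx_mul trmxK.
have Lo : L *m o = 0 by apply: laplacian_ones.
have oL : o^T *m L = 0 by rewrite -LT -trmx_mul Lo trmx0.
have LJ : L *m J = 0 by rewrite -scalemxAr mulmxA Lo mul0mx scaler0.
have JL : J *m L = 0 by rewrite -LT -JT -trmx_mul LJ trmx0.
have JJ : J *m J = J.
  by rewrite {2}/J -scalemxAr mulmxA Jo.
have KT : K^T = K by rewrite linearD /= LT JT.
have Ku : K \in unitmx.
  rewrite -row_free_unit -kermx_eq0; apply/eqP/row_matrixP => i.
  rewrite row0; set y := row i _.
  have yK : y *m K = 0 by apply/sub_kermxP; exact: row_sub.
  pose x := y^T.
  have Kx : K *m x = 0 by rewrite -KT -trmx_mul yK trmx0.
  have Jx : J *m x = 0.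
    by have := congr1 (mulmx J) Kx; rewrite mulmxA mulmxDr JL JJ add0r mulmx0.
  have Lx : L *m x = 0 by move: Kx; rewrite mulmxDl Jx addr0.
  have xc := laplacian_ker es ec Lx.
  have xo : x = x i0 0 *: o.
    by apply/matrixP => k l; rewrite ord1 !mxE mulr1; have := xc k i0; rewrite !mxE.
  apply: trmx_inj; rewrite trmx0 -/x xo; move: Jx.
  by rewrite {1}xo -scalemxAr Jo.
exists (invmx K - J).
have KJ : K *m J = J by rewrite mulmxDl LJ JJ add0r.
have JK : J *m K = J by rewrite mulmxDr JL JJ add0r.
have KVJ : invmx K *m J = J by rewrite -{1}KJ mulKmx.
have JKV : J *m invmx K = J by rewrite -{1}JK mulmxK.
have LE : L = K - J by rewrite /K addrK.
split.
- by rewrite linearB /= trmx_inv KT JT.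
- by rewrite LE mulmxBl !mulmxBr mulmxV // JKV KJ JJ subrr subr0.
- by rewrite LE mulmxBl !mulmxBr mulVmx // KVJ JK JJ subrr subr0.
- by rewrite -/o -Jo mulmxA mulmxBl KVJ JJ subrr mul0mx.
Qed.

End Pseudoinverse.

(* Main.v *)
Require Import Defs.
From mathcomp Require Import all_boot all_order all_algebra.
From mathcomp Require Import reals.
Set Implicit Arguments.
Unset Strict Implicit.
Unset Printing Implicit Defensive.
Import Order.TTheory GRing.Theory Num.Theory.
Local Open Scope ring_scope.

(** Let [P] be the pseudoinverse of the Laplacian and [d] the column of its
    diagonal entries. The resistance matrix is [d 1^T + 1 d^T - 2 P], and
    [P 1 = 0], so its row sums are [n d + tr(P) 1]. Hence the resistance
    Laplacian is [n diag(d) + tr(P) I + 2 P] minus the two rank-one matrices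
    [d 1^T] and [1 d^T] ([resistance_laplacianE], where [diag(d)] is split into
    its mean and the deviation matrix). Compression by [U] kills both rank-one
    terms because the columns of [U] are orthogonal to [1], and it turns [P]
    into the diagonal matrix of the [1 / lam] because the Laplacian eigenvectors
    orthogonal to [1] are eigenvectors of [P] with inverse eigenvalues
    ([laplacian_pinv_eigen]).

    That the compression is the matrix of the restriction is a general fact
    about any orthonormal basis of [1^perp] and any symmetric matrix
    annihilating [1] ([represents_restriction_compression]). *)

Section OnesComplement.
Variables (R : realType) (n : nat).

Lemma ones_dot : (ones R n)^T *m ones R n = n%:R%:M.
Proof.
apply/matrixP => i j; rewrite !ord1 !mxE.
rewrite (eq_bigr (fun=> 1)); last by move=> k _; rewrite !mxE mulr1.
by rewrite sumr_const card_ord.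
Qed.

Lemma mxrank_ones_orth : (0 < n)%N -> \rank (ones_orth R n) = n.-1.
Proof.
move=> n_gt0; rewrite mxrank_ker.
suff -> : \rank (ones R n) = 1%N by rewrite subn1.
apply/eqP; rewrite eqn_leq rank_leq_col /= lt0n mxrank_eq0.
apply/eqP => /matrixP /(_ (Ordinal n_gt0) 0).
by rewrite !mxE => /eqP; rewrite oner_eq0.
Qed.

(** Orthonormality makes the [n.-1] columns independent, so they fill the
    [n.-1]-dimensional space [1^perp]. *)
Lemma orthonormal_ones_orth (U : 'M[R]_(n, n.-1)) : (0 < n)%N ->
  U^T *m U = 1%:M -> U^T *m ones R n = 0 ->
  (U^T == ones_orth R n)%MS /\ row_free U^T.
Proof.
move=> n_gt0 UU Uo.
have Ufree : row_free U^T by apply/row_freeP; exists U.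
split=> //; rewrite -(geq_leqif (mxrank_leqif_eq _)); last exact/sub_kermxP.
by rewrite (mxrank_ones_orth n_gt0) (eqP Ufree).
Qed.

(** By symmetry the image of [T] is orthogonal to [1], so [T U = U X] for some
    [X]; multiplying on the left by [U^T] identifies [X] as [U^T T U]. *)
Lemma represents_restriction_compression (T : 'M[R]_n) (U : 'M[R]_(n, n.-1)) :
    (0 < n)%N -> T^T = T -> T *m ones R n = 0 ->
    U^T *m U = 1%:M -> U^T *m ones R n = 0 ->
  represents_restriction (ones_orth R n) T U (U^T *m T *m U).
Proof.
move=> n_gt0 TT To UU Uo.
have [Uorth Ufree] := orthonormal_ones_orth n_gt0 UU Uo.
split=> //; first by apply/sub_kermxP; rewrite TT -mulmxA To mulmx0.
have : (U^T *m T <= U^T)%MS.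
  by rewrite (eqmxP Uorth); apply/sub_kermxP; rewrite -mulmxA To mulmx0.
case/submxP => X UTX.
have TU : T *m U = U *m X^T.
  by apply: trmx_inj; rewrite !trmx_mul trmxK TT.
by rewrite -(mulmxA _ T) TU (mulmxA U^T) UU mul1mx.
Qed.

End OnesComplement.

Section ResistanceLaplacian.
Variables (R : realType) (n : nat) (e : rel 'I_n).
Local Notation P := (laplacian_pinv R e).
Local Notation "1n" := (ones R n).
Let d : 'cV[R]_n := \col_i P i i.

Lemma resistance_mxE :
  resistance_mx R e = d *m 1n^T + 1n *m d^T - 2 *: P.
Proof.
apply/matrixP => i j.
by rewrite !mxE /effective_resistance !big_ord1 !mxE mulr1 mul1r.
Qed.

Lemma resistance_laplacian_sym :
  P^T = P -> (resistance_laplacian R e)^T = resistance_laplacian R e.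
Proof.
move=> PT; rewrite /resistance_laplacian linearB /= tr_diag_mx resistance_mxE; congr (_ - _).
by rewrite linearB linearD linearZ /= !trmx_mul !trmxK PT (addrC (1n *m _)).
Qed.

Lemma resistance_laplacian_ones : resistance_laplacian R e *m 1n = 0.
Proof.
rewrite mulmxBl; apply/eqP; rewrite subr_eq0; apply/eqP/matrixP => i j.
by rewrite ord1 mul_diag_mx [LHS]mxE [1n i 0]mxE mulr1 mxE.
Qed.

(** The multiple of the identity collects [tr(P) I], which comes from the row
    sums of the resistance matrix, and the equal mean part of [n diag(d)]. *)
Lemma resistance_laplacianE : (0 < n)%N -> P *m 1n = 0 ->
  resistance_laplacian R e =
    (2 * n%:R * mean_pinv_diag R e)%:M + 2 *: P +
    n%:R *: resistance_deviation R e - (d *m 1n^T + 1n *m d^T).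
Proof.
move=> n_gt0 P1.
have trE : n%:R * mean_pinv_diag R e = \tr P.
  by rewrite mulrA mulfV ?mul1r // pnatr_eq0 -lt0n.
have d1 : d^T *m 1n = (\tr P)%:M.
  apply/matrixP => i j; rewrite !ord1 !mxE.
  by apply: eq_bigr => k _; rewrite !mxE mulr1.
have rowsum : resistance_mx R e *m 1n = n%:R *: d + \tr P *: 1n.
  rewrite resistance_mxE mulmxBl mulmxDl -!mulmxA ones_dot d1 !mul_mx_scalar.
  by rewrite -scalemxAl P1 scaler0 subr0.
have diagE : diag_mx (resistance_mx R e *m 1n)^T =
    (2 * n%:R * mean_pinv_diag R e)%:M + n%:R *: resistance_deviation R e.
  rewrite rowsum -mulrA trE; apply/matrixP => i j; rewrite !mxE mulr1.
  case: eqVneq => [->|_]; last by rewrite !mulr0n subrr mulr0 addr0.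
  by rewrite !mulr1n mulrBr trE (mulr_natl _ 2) mulr2n addrACA subrr addr0 addrC.
rewrite /resistance_laplacian diagE resistance_mxE opprB addrCA.
by rewrite addrA [in LHS]addrA (addrC (2 *: P)).
Qed.

(** [P L] is the projection onto [1^perp], hence fixes [x], while it also
    equals [mu P] on [x]. *)
Lemma laplacian_pinv_eigen (x : 'cV[R]_n) (mu : R) :
    P *m laplacian R e = centering R n -> 1n^T *m x = 0 ->
    laplacian R e *m x = mu *: x -> mu != 0 ->
  P *m x = mu^-1 *: x.
Proof.
move=> PL ox Lx mu0; apply: (scalerI mu0).
rewrite scalerA mulfV // scale1r scalemxAr -Lx mulmxA PL mulmxBl mul1mx.
by rewrite -scalemxAl -mulmxA ox mulmx0 scaler0 subr0.
Qed.

End ResistanceLaplacian.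

Theorem theorem2p12 (R : realType) (n : nat) (n_gt1 : (1 < n)%N)
    (e : rel 'I_n) (e_simple : simple_graph e) (e_conn : connected_graph e)
    (lam : 'I_n -> R) (u : 'I_n -> 'cV[R]_n)
    (eigen : laplacian_eigenbasis e n_gt1 lam u) :
  let i1 : 'I_n := Ordinal (ltnW n_gt1) in
  let U : 'M[R]_(n, n.-1) := \matrix_(i, k) u (lift i1 k) i 0 in
  let DL : 'M[R]_n.-1 := diag_mx (\row_k (1 / lam (lift i1 k))) in
  let ML : 'M[R]_n.-1 := U^T *m resistance_deviation R e *m U in
  represents_restriction (ones_orth R n) (resistance_laplacian R e) U
    (U^T *m resistance_laplacian R e *m U) /\
  U^T *m resistance_laplacian R e *m U =
    (2 * n%:R * mean_pinv_diag R e)%:M + 2 *: DL + n%:R *: ML.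
Proof.
have n_gt0 := ltnW n_gt1.
move=> i1 U DL ML; have [es _] := e_simple.
have [PT _ PL P1] := laplacian_pinvP R es e_conn.
have [[_ lam2_gt0] lam_mono Lu u_orth u1] := eigen.
have colU k : col k U = u (lift i1 k).
  by apply/matrixP => i j; rewrite ord1 !mxE.
have UE m (A : 'M[R]_(n, m)) k l :
    (U^T *m A) k l = ((u (lift i1 k))^T *m col l A) 0 0.
  by rewrite -colU !mxE; apply: eq_bigr => i _; rewrite !mxE.
have uo k : (u (lift i1 k))^T *m ones R n = 0.
  have := u_orth (lift i1 k) i1.
  rewrite u1 -scalemxAr eq_sym (negPf (neq_lift _ _)) raddf0 => /eqP.
  by rewrite scaler_eq0 invr_eq0 sqrtr_eq0 lern0 eqn0Ngt n_gt0 => /eqP.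
have ou k : (ones R n)^T *m u (lift i1 k) = 0.
  by rewrite -[u _]trmxK -trmx_mul uo trmx0.
have Uo : U^T *m ones R n = 0.
  by apply/matrixP => k l; rewrite UE col_id uo !mxE.
have UU : U^T *m U = 1%:M.
  apply/matrixP => k l; rewrite UE colU u_orth !mxE eqxx mulr1n.
  by rewrite (inj_eq lift_inj).
(* [lift i1 k] has index at least 1, so monotonicity bounds its eigenvalue
   below by the second one. *)
have lam_neq0 k : lam (lift i1 k) != 0.
  by rewrite gt_eqF // (lt_le_trans lam2_gt0) // lam_mono.
have PU : laplacian_pinv R e *m U = U *m DL.
  apply/matrixP => i k; rewrite mul_mx_diag.
  have -> : (laplacian_pinv R e *m U) i k = col k (laplacian_pinv R e *m U) i 0.
    by rewrite [RHS]mxE.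
  rewrite colE -mulmxA -colE colU (laplacian_pinv_eigen PL (ou k) (Lu _) (lam_neq0 k)).
  by rewrite !mxE div1r mulrC.
split.
  apply: represents_restriction_compression => //.
    exact: resistance_laplacian_sym.
  exact: resistance_laplacian_ones.
have oU : (ones R n)^T *m U = 0 by rewrite -[U]trmxK -trmx_mul Uo trmx0.
rewrite resistance_laplacianE // mulmxBr mulmxBl.
(* The rank-one part vanishes between [U^T] and [U]. *)
rewrite [X in _ - X](_ : _ = 0) ?subr0; last first.
  rewrite mulmxDr mulmxDl -mulmxA -(mulmxA _ _ U) oU !mulmx0 add0r.
  by rewrite mulmxA Uo !mul0mx.
rewrite !mulmxDr !mulmxDl mul_mx_scalar -scalemxAl UU scalemx1.
by rewrite -!scalemxAr -!scalemxAl -(mulmxA _ _ U) PU mulmxA UU mul1mx.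
Qed.
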